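(* Let $j\ge1$, let $\Upsilon\subseteq S_j$ be any set of permutations, let $\Upsilon_0=\{(\tau,0^j):\tau\in\Upsilon\}$ (where $0^j$ is the word of $j$ zeros), and let $\Gamma=\Upsilon_0\cup\{(1\text{-}2,1~0),(2\text{-}1,1~0)\}$. Then for every $k\ge1$, $$\sum_{n\ge0}Av_{n,k}^{\Gamma}\frac{t^n}{n!}=\Big(\sum_{n\ge0}Av_n^{\Upsilon}\frac{t^n}{n!}\Big)^k$$ as formal power series in $t$.
   Context: For integers $k\ge1$, $n\ge0$, $C_k\wr S_n$ denotes the set of pairs $(\sigma,w)$ where $\sigma=\sigma_1\cdots\sigma_n$ is a permutation of $\{1,\dots,n\}$ in one-line notation and $w=w_1\cdots w_n\in\{0,1,\dots,k-1\}^n$. For a sequence of distinct integers, $\mathrm{red}$ replaces the $i$-th smallest entry by $i$; for a word over nonnegative integers, $\mathrm{red}$ replaces every occurrence of the $i$-th smallest distinct letter by $i-1$. A pattern $(\tau,u)$ has $\tau\in S_m$ and $u$ a word of length $m$ with $\mathrm{red}(u)=u$; e.g. $(2\text{-}1,1~0)$ means $\tau=21$, $u=10$. $(\tau,u)$ bi-occurs in $(\sigma,w)$ if there are $1\le i_1<\cdots<i_m\le n$ (not necessarily adjacent) with $\mathrm{red}(\sigma_{i_1}\cdots\sigma_{i_m})=\tau$ and $\mathrm{red}(w_{i_1}\cdots w_{i_m})=u$; $(\sigma,w)$ bi-avoids a set of patterns if no member bi-occurs in it. $Av_{n,k}^{\Gamma}$ is the number of elements of $C_k\wr S_n$ bi-avoiding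 $\Gamma$ (with $Av_{0,k}^\Gamma=1$). A permutation $\sigma\in S_n$ avoids $\Upsilon$ if there are no indices $i_1<\cdots<i_j$ with $\mathrm{red}(\sigma_{i_1}\cdots\sigma_{i_j})\in\Upsilon$; $Av_n^{\Upsilon}$ is the number of such $\sigma\in S_n$ (with $Av_0^\Upsilon=1$). *)

(* Defs.v *)
From HB Require Import structures.
From mathcomp Require Import all_boot all_order all_fingroup all_algebra.

Set Implicit Arguments.
Unset Strict Implicit.
Unset Printing Implicit Defensive.

Import GRing.Theory.

(* Permutations of {1, ..., n} are elements of 'S_n, acting on {0, ..., n - 1};
   the shift to {1, ..., n} takes place in the one-line notation. *)
Definition one_line (n : nat) (s : 'S_n) : seq nat :=
  [seq (val (s i)).+1 | i <- enum 'I_n].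

(* Meant for sequences of distinct integers: the i-th smallest entry becomes i,
   with i counted from 1. *)
Definition red_perm (s : seq nat) : seq nat :=
  [seq (count (fun y => y < x) s).+1 | x <- s].

(* The i-th smallest distinct letter becomes i - 1. *)
Definition red_word (w : seq nat) : seq nat :=
  [seq count (fun y => y < x) (undup w) | x <- w].

Definition increasing (n m : nat) (I : m.-tuple 'I_n) : bool :=
  sorted ltn [seq val i | i <- I].

(* C_k wr S_n as a set of pairs (sigma, w). *)
Definition colored_perm (k n : nat) : finType := ('S_n * n.-tuple 'I_k)%type.

Record pattern := Pattern {
  pat_size : nat;
  pat_perm : 'S_pat_size;
  pat_word : pat_size.-tuple nat;
  pat_reduced : red_word pat_word = pat_word
}.

Definition bi_occurs (k n : nat) (p : pattern) (x : colored_perm k n) : bool :=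
  [exists I : (pat_size p).-tuple 'I_n,
    [&& increasing I,
        red_perm [seq (val (x.1 i)).+1 | i <- I] == one_line (pat_perm p)
      & red_word [seq val (tnth x.2 i) | i <- I] == pat_word p]].

(* Only finite sets of patterns are needed; they are given by enumerations. *)
Definition bi_avoids (k n : nat) (G : seq pattern) (x : colored_perm k n) :
    bool :=
  all (fun p => ~~ bi_occurs p x) G.

Definition Av_colored (G : seq pattern) (n k : nat) : nat :=
  #|[set x : colored_perm k n | bi_avoids G x]|.

Definition perm_avoids (j n : nat) (Y : {set 'S_j}) (s : 'S_n) : bool :=
  ~~ [exists I : j.-tuple 'I_n,
       increasing I &&
       [exists t in Y,
         red_perm [seq (val (s i)).+1 | i <- I] == one_line t]].

Definition Av_perm (j : nat) (Y : {set 'S_j}) (n : nat) : nat :=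
  #|[set s : 'S_n | perm_avoids Y s]|.

Lemma red_word_nseq0 (j : nat) : red_word (nseq_tuple j 0) = nseq_tuple j 0.
Proof.
rewrite /red_word /= map_nseq; congr (nseq j _).
by rewrite (eq_count (a2 := pred0)) ?count_pred0.
Qed.

Definition zero_pattern (j : nat) (t : 'S_j) : pattern :=
  Pattern t (red_word_nseq0 j).

Lemma red_word_10 : red_word [tuple 1; 0] = [tuple 1; 0].
Proof. by []. Qed.

(* (1-2, 1 0) *)
Definition pattern_12_10 : pattern := Pattern (1%g : 'S_2) red_word_10.

(* (2-1, 1 0) *)
Definition pattern_21_10 : pattern :=
  Pattern (tperm ord0 ord_max : 'S_2) red_word_10.

Lemma one_line_12 : one_line (pat_perm pattern_12_10) = [:: 1; 2].
Proof. by rewrite /one_line !enum_ordSl enum_ord0 /= !perm1. Qed.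

Lemma one_line_21 : one_line (pat_perm pattern_21_10) = [:: 2; 1].
Proof.
rewrite /one_line !enum_ordSl enum_ord0 /= tpermL.
by have -> : lift ord0 ord0 = ord_max :> 'I_2 by [apply: val_inj]; rewrite tpermR.
Qed.

(* The conventions for n = 0 hold when no pattern is empty. *)
Lemma Av_colored0 (G : seq pattern) (k : nat) :
  all (fun p => 0 < pat_size p) G -> Av_colored G 0 k = 1.
Proof.
move=> G_gt0; rewrite /Av_colored.
have -> : [set x : colored_perm k 0 | bi_avoids G x] = setT.
  apply/setP=> x; rewrite !inE; apply: sub_all G_gt0 => -[[|m] t u ru] //= _.
  by apply/existsP=> -[I _]; case: (thead I).
by rewrite cardsT card_prod card_tuple card_Sn.
Qed.

Lemma Av_perm0 (j : nat) (Y : {set 'S_j}) : 0 < j -> Av_perm Y 0 = 1.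
Proof.
case: j Y => // j Y _; rewrite /Av_perm.
have -> : [set s : 'S_0 | perm_avoids Y s] = setT.
  by apply/setP=> s; rewrite !inE; apply/existsP=> -[I _]; case: (thead I).
by rewrite cardsT card_Sn.
Qed.

Local Open Scope ring_scope.

(* Formal power series over R, given by their coefficients and compared with
   pointwise equality. *)
Definition fps (R : nzRingType) : Type := nat -> R.

Definition fps_one (R : nzRingType) : fps R := fun n => (n == 0%N)%:R.

Definition fps_mul (R : nzRingType) (f g : fps R) : fps R :=
  fun n => \sum_(i < n.+1) f i * g (n - i)%N.

Definition fps_exp (R : nzRingType) (f : fps R) (k : nat) : fps R :=
  iter k (fps_mul f) (fps_one R).

Definition egf (a : nat -> nat) : fps rat := fun n => (a n)%:R / (n`!)%:R.

(* Main.v *)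
(* Avoiding 1-2 and 2-1 coloured 1 0 says that the colour word is weakly
   increasing, so the permutation is cut into k consecutive blocks, one for each
   colour, and each block must avoid Y on its own.  Avoidance depends only on
   the order type of a block, hence peeling off the last block of n - m letters
   costs a factor 'C(n, m) for the choice of its values and Av_perm Y (n - m)
   for their arrangement: the counts satisfy a binomial convolution, that is, a
   product of exponential generating functions. *)
Require Import Defs.
From mathcomp Require Import all_boot all_order all_fingroup all_algebra.
From mathcomp Require Import ring.

Set Implicit Arguments.
Unset Strict Implicit.
Unset Printing Implicit Defensive.

Import GRing.Theory Num.Theory.

(** * Order-invariant predicates on permutations of a list *)

Lemma perm_eq_of_size (T : eqType) (s t : seq T) :
  uniq s -> {subset s <= t} -> size s = size t -> perm_eq s t.
Proof.
move=> s_uniq s_t st; have le_ts : size t <= size s by rewrite st.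
apply: uniq_perm => //; first exact: leq_size_uniq s_uniq s_t le_ts.
by have [] := uniq_min_size s_uniq s_t le_ts.
Qed.

(** Both lists have [(size s)]! entries, so injectivity on the left and one inclusion suffice. *)
Lemma permutations_map (T T' : eqType) (f : T -> T') (s : seq T) :
  uniq s -> {in s &, injective f} ->
  perm_eq [seq map f p | p <- permutations s] (permutations (map f s)).
Proof.
move=> s_uniq f_inj; apply: perm_eq_of_size.
- rewrite map_inj_in_uniq ?permutations_uniq // => p q.
  rewrite !mem_permutations => /perm_mem ps /perm_mem qs.
  apply: (inj_in_map (A := mem s)) => //; last first.
  + by apply/allP=> x; rewrite -qs.
  + by apply/allP=> x; rewrite -ps.
- by move=> _ /mapP[p + ->]; rewrite !mem_permutations; apply: perm_map.
- by rewrite size_map !size_permutations ?map_inj_in_uniq ?size_map.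
Qed.

(** Dependence on the order type alone. Monotonicity is asked only on the entries of [p], because
    relabellings such as [nth 0 t] increase only within the range of [t]. *)
Definition order_invariant (Q : pred (seq nat)) : Prop :=
  forall (f : nat -> nat) (p : seq nat),
    {in p &, {mono f : x y / x < y}} -> Q (map f p) = Q p.

Lemma mono_ltn_inj_in (f : nat -> nat) (p : seq nat) :
  {in p &, {mono f : x y / x < y}} -> {in p &, injective f}.
Proof.
move=> f_mono x y px py fxy; case: (ltngtP x y) => //.
- by rewrite -f_mono // fxy ltnn.
- by rewrite -f_mono // fxy ltnn.
Qed.

Definition num_perms (Q : pred (seq nat)) (n : nat) : nat :=
  count Q (permutations (iota 0 n)).

(** Relabelling by [nth 0 t], with [t] the sorted form of [s], carries the permutations of
    [iota 0 (size s)] onto those of [s] and keeps order types. *)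
Lemma count_permutations (Q : pred (seq nat)) (s : seq nat) :
  order_invariant Q -> uniq s ->
  count Q (permutations s) = num_perms Q (size s).
Proof.
move=> Qinv s_uniq; set t := sort leq s.
have t_s : perm_eq t s by rewrite perm_sort.
have size_t : size t = size s by apply: perm_size.
have t_sorted : sorted ltn t.
  by rewrite ltn_sorted_uniq_leq sort_uniq s_uniq sort_sorted //;
    apply: leq_total.
have t_mono : {in iota 0 (size s) &, {mono nth 0 t : x y / x < y}}.
  apply: leqW_mono_in; apply: leq_mono_in => x y.
  rewrite !mem_iota /= -size_t => xs ys.
  exact: (sorted_ltn_nth ltn_trans).
rewrite -(seq.permP (perm_permutations t_s)) -(take_size t).
rewrite -(map_nth_iota0 0 (leqnn _)) size_t.
have /seq.permP <- :=
  permutations_map (iota_uniq 0 (size s)) (mono_ltn_inj_in t_mono).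
rewrite count_map; apply: eq_in_count => p /=; rewrite mem_permutations.
move=> /perm_mem ps; apply: Qinv => x y; rewrite !ps; exact: t_mono.
Qed.

(** * Cutting a permutation after its first [m] positions *)

Section Shuffle.

Variables (n m : nat).
Hypothesis le_mn : m <= n.

Let vals (A : {set 'I_n}) : seq nat := [seq val i | i <- enum A].

Let vals_uniq (A : {set 'I_n}) : uniq (vals A).
Proof. by rewrite map_inj_uniq ?enum_uniq //; apply: val_inj. Qed.

Let size_vals (A : {set 'I_n}) : size (vals A) = #|A|.
Proof. by rewrite size_map -cardE. Qed.

(** One inner list for each candidate set [A] of values in the first [m] positions. *)
Let shuffles : seq (seq nat) :=
  flatten [seq [seq p ++ q | p <- permutations (vals A),
                             q <- permutations (vals (~: A))]
          | A <- enum [set A : {set 'I_n} | #|A| == m]].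

(** For fixed [A] the two parts vary independently, and by order invariance their product of counts
    is the same for each of the ['C(n, m)] sets [A]. *)
Let count_shuffles (Q R : pred (seq nat)) :
  order_invariant Q -> order_invariant R ->
  count (fun p => Q (take m p) && R (drop m p)) shuffles =
  'C(n, m) * (num_perms Q m * num_perms R (n - m)).
Proof.
move=> Qinv Rinv; rewrite -[n in 'C(n, _)]card_ord -card_draws.
rewrite -sum1_count /shuffles big_flatten big_map -sum_nat_const -big_enum.
rewrite big_seq [RHS]big_seq; apply: eq_bigr => A;
  rewrite mem_enum inE => /eqP cardA.
have -> : num_perms Q m = \sum_(p <- permutations (vals A)) Q p.
  by rewrite -cardA -size_vals -count_permutations // -sum1_count big_mkcond.
have -> : num_perms R (n - m) = \sum_(p <- permutations (vals (~: A))) R p.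
  have <- : #|~: A| = n - m by rewrite cardsCs setCK card_ord cardA.
  rewrite -size_vals.
  by rewrite -count_permutations // -sum1_count big_mkcond.
rewrite big_distrl big_mkcond big_allpairs_dep big_seq [RHS]big_seq.
apply: eq_bigr => p; rewrite mem_permutations => /perm_size.
rewrite size_vals cardA => size_p; rewrite big_distrr.
apply: eq_bigr => q _ /=; rewrite -size_p take_size_cat // drop_size_cat //.
by case: (Q p); case: (R q).
Qed.

Let perm_shuffles : perm_eq (permutations (iota 0 n)) shuffles.
Proof.
apply: perm_eq_of_size; first exact: permutations_uniq.
  move=> p; rewrite mem_permutations => p_iota.
  have p_uniq : uniq p by rewrite (perm_uniq p_iota) iota_uniq.
  have size_p : size p = n by rewrite (perm_size p_iota) size_iota.
  have p_lt x : x \in p -> x < n by rewrite (perm_mem p_iota) mem_iota.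
  have mem_p x : (x \in p) = (x \in take m p) || (x \in drop m p).
    by rewrite -mem_cat cat_take_drop.
  pose A := [set i : 'I_n | val i \in take m p].
  have take_A : perm_eq (take m p) (vals A).
    apply: uniq_perm; rewrite ?take_uniq ?vals_uniq // => x.
    apply/idP/mapP=> [xp | [i + ->]]; last by rewrite mem_enum inE.
    have xn : x < n by rewrite p_lt // mem_p xp.
    by exists (Ordinal xn); rewrite // mem_enum inE.
  have drop_A : perm_eq (drop m p) (vals (~: A)).
    move: (p_uniq); rewrite -{1}(cat_take_drop m p) cat_uniq.
    move=> /and3P[_ /hasPn dis _].
    apply: uniq_perm; rewrite ?drop_uniq ?vals_uniq // => x.
    apply/idP/mapP=> [xp | [i + ->]].
      have xn : x < n by rewrite p_lt // mem_p xp orbT.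
      by exists (Ordinal xn); rewrite // mem_enum !inE; apply: dis.
    rewrite mem_enum !inE => /negPf iN.
    have : val i \in p by rewrite (perm_mem p_iota) mem_iota /=.
    by rewrite mem_p iN.
  apply/flattenP; exists [seq p ++ q | p <- permutations (vals A),
                                       q <- permutations (vals (~: A))].
    apply: map_f; rewrite mem_enum inE -size_vals -(perm_size take_A).
    by rewrite size_takel ?size_p.
  apply/allpairsPdep; exists (take m p), (drop m p).
  by rewrite !mem_permutations cat_take_drop.
(* The size of [shuffles] is [count_shuffles] for always-true predicates, so equality of sizes is
   ['C(n, m)] m! (n - m)! = n!. *)
rewrite size_permutations ?iota_uniq // size_iota -[RHS]count_predT.
rewrite (count_shuffles (Q := predT) (R := predT)) // /num_perms !count_predT.
by rewrite !size_permutations ?iota_uniq // !size_iota bin_fact.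
Qed.

(* A permutation is determined by the set of the values in its first m positions
   and by the order types of its two parts. *)
Lemma num_perms_take_drop (Q R : pred (seq nat)) :
  order_invariant Q -> order_invariant R ->
  num_perms (fun p => Q (take m p) && R (drop m p)) n =
  'C(n, m) * (num_perms Q m * num_perms R (n - m)).
Proof.
by move=> Qinv Rinv; rewrite -count_shuffles // /num_perms (seq.permP
  perm_shuffles).
Qed.

End Shuffle.

(** * Reductions, one-line notation and index tuples *)

Lemma mono_ltn_subseq (f : nat -> nat) (r s : seq nat) :
  subseq r s -> {in s &, {mono f : x y / x < y}} ->
  {in r &, {mono f : x y / x < y}}.
Proof. by move=> /mem_subseq rs f_mono x y /rs sx /rs; apply: f_mono. Qed.

Lemma red_perm_map (f : nat -> nat) (s : seq nat) :
  {in s &, {mono f : x y / x < y}} -> red_perm (map f s) = red_perm s.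
Proof.
move=> f_mono; rewrite /red_perm -map_comp; apply/eq_in_map => x sx /=.
by rewrite count_map; congr _.+1; apply: eq_in_count => y sy /=; rewrite f_mono.
Qed.

Lemma size_one_line (n : nat) (s : 'S_n) : size (one_line s) = n.
Proof. by rewrite size_map size_enum_ord. Qed.

Lemma one_line_uniq (n : nat) (s : 'S_n) : uniq (one_line s).
Proof.
rewrite /one_line map_inj_uniq ?enum_uniq // => i i' [].
by move/val_inj/perm_inj.
Qed.

(** One-line notation takes its values from 1 on and [num_perms] from 0 on; order invariance absorbs
    the shift. *)
Lemma count_one_line (n : nat) (Q : pred (seq nat)) :
  order_invariant Q -> #|[set s : 'S_n | Q (one_line s)]| = num_perms Q n.
Proof.
move=> Qinv; have iota_u := iota_uniq 1 n.
have -> : num_perms Q n = count Q (permutations (iota 1 n)).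
  by rewrite count_permutations // size_iota.
suff /seq.permP <- : perm_eq [seq one_line s | s : 'S_n] (permutations (iota 1
  n)).
  by rewrite cardsE cardE size_filter count_map enumT; apply: eq_count => s.
apply: perm_eq_of_size.
- rewrite map_inj_uniq ?enum_uniq // => s t.
  rewrite /one_line => /eq_in_map st.
  by apply/permP=> i; have [] := st i (mem_enum _ i) => /val_inj.
- move=> _ /mapP[s _ ->]; rewrite mem_permutations.
  apply: perm_eq_of_size; rewrite ?one_line_uniq ?size_one_line ?size_iota //.
  by move=> _ /mapP[i _ ->]; rewrite mem_iota /= add1n ltnS ltn_ord.
- by rewrite size_map -cardE card_Sn size_permutations ?size_iota.
Qed.

(** Lets occurrences be handled by [subseq] and [mask]. A strictly sorted list is determined by its
    elements, so it is a filter of [enum 'I_n]. *)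
Lemma increasing_subseq (n m : nat) (I : m.-tuple 'I_n) :
  increasing I = subseq I (enum 'I_n).
Proof.
pose lt (i i' : 'I_n) := i < i'.
have lt_tr : transitive lt by move=> ? ? ?; apply: ltn_trans.
have lt_irr : irreflexive lt by move=> ?; apply: ltnn.
have enum_sorted : sorted lt (enum 'I_n).
  by have := iota_ltn_sorted 0 n; rewrite -val_enum_ord sorted_map.
rewrite /increasing sorted_map; apply/idP/idP=> [I_sorted | sub].
  suff -> : tval I = [seq i <- enum 'I_n | i \in I] by apply: filter_subseq.
  apply: (irr_sorted_eq lt_tr lt_irr I_sorted).
    exact: (subseq_sorted lt_tr (filter_subseq _ _) enum_sorted).
  by move=> i; rewrite mem_filter mem_enum andbT.
exact: (subseq_sorted lt_tr sub enum_sorted).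
Qed.

(** A letter reduces to 0 exactly when no letter is below it; if this holds for all letters, any two
    are equal. *)
Lemma red_word_constant (m : nat) (w : seq nat) :
  size w = m -> (red_word w == nseq m 0) = constant w.
Proof.
move<-; have -> : size w = size (red_word w) by rewrite size_map.
rewrite (sameP eqP (all_pred1P _ _)) all_map.
apply/allP/(constantP 0)=> [w_min | [c ->] x]; last first.
  case/nseqP=> -> _ /=; rewrite (eq_in_count (a2 := pred0)) ?count_pred0 // =>
    y.
  by rewrite mem_undup => /nseqP[-> _]; rewrite ltnn.
have w_le x y : x \in w -> y \in w -> x <= y.
  move=> xw yw; rewrite leqNgt; apply/negP=> yx.
  move: (w_min x xw); rewrite /= -leqn0 leqNgt -has_count => /hasPn/(_ y).
  by rewrite mem_undup yx => /(_ yw).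
case: w {w_min} w_le => [|c w] w_le; first by exists 0.
exists c; apply/all_pred1P/allP=> x xw /=.
by rewrite eqn_leq !w_le ?mem_head.
Qed.

(** * Avoidance for sequences, and colour by colour *)

Section Avoidance.

Variables (j : nat) (Y : {set 'S_j}).

(** Stated for bare sequences because a colour class is only a subsequence of a permutation. Bit
    masks encode subsequences by a finite type, which keeps the predicate boolean. *)
Definition avoids_seq (s : seq nat) : bool :=
  ~~ [exists b : (size s).-tuple bool,
       [exists t in Y, red_perm (mask b s) == one_line t]].

Lemma avoids_seqP (s : seq nat) :
  reflect (forall r t, subseq r s -> t \in Y -> red_perm r <> one_line t)
          (avoids_seq s).
Proof.
apply: (iffP existsPn) => [av r t /subseqP[b size_b ->] tY rt | av b].
  case/existsP: (av (Tuple (introT eqP size_b))).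
  by exists t; rewrite tY rt eqxx.
apply/existsP=> -[t /andP[tY /eqP]]; apply: av tY; exact: mask_subseq.
Qed.

Lemma avoids_seq_invariant : order_invariant avoids_seq.
Proof.
move=> f p f_mono; apply/avoids_seqP/avoids_seqP=> av r t.
  move=> rp tY rt; apply: (av (map f r) t) => //; first exact: map_subseq.
  by rewrite red_perm_map //; apply: mono_ltn_subseq f_mono.
case/subseqP=> b _ ->; rewrite -map_mask => tY.
rewrite red_perm_map; first exact: av (mask_subseq _ _) tY.
exact: mono_ltn_subseq (mask_subseq _ _) f_mono.
Qed.

Lemma perm_avoidsE (n : nat) (s : 'S_n) :
  perm_avoids Y s = avoids_seq (one_line s).
Proof.
apply/existsPn/avoids_seqP=> [av r t sub tY rt | av I].
  (* [avoids_seq] does not fix the length of a subsequence, but [red_perm] preserves length. *)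
  have size_r : size r = j by rewrite -(size_one_line t) -rt size_map.
  case/subseqP: sub rt size_r => b _ ->; rewrite /one_line -map_mask => rt.
  rewrite size_map => /eqP size_r.
  move: (av (Tuple size_r)); rewrite increasing_subseq mask_subseq /=.
  by case/existsP; exists t; rewrite tY; apply/eqP.
rewrite increasing_subseq; apply/andP=> -[sub /existsP[t /andP[tY /eqP]]].
by apply: av tY; rewrite map_subseq.
Qed.

Lemma Av_permE (n : nat) : Av_perm Y n = num_perms avoids_seq n.
Proof.
rewrite -(count_one_line n avoids_seq_invariant) /Av_perm.
by congr #|pred_of_set _|; apply/setP=> s; rewrite !inE perm_avoidsE.
Qed.

Definition avoids_colorwise (k : nat) (w s : seq nat) : bool :=
  all (fun c => avoids_seq (mask [seq x == c | x <- w] s)) (iota 0 k).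

Lemma avoids_colorwise_invariant (k : nat) (w : seq nat) :
  order_invariant (avoids_colorwise k w).
Proof.
move=> f p f_mono; apply: eq_all => c; rewrite -map_mask.
apply: avoids_seq_invariant; apply: mono_ltn_subseq f_mono; exact: mask_subseq.
Qed.

(** All letters of [w] are below [k], so the class of colour [k] is exactly the tail of [s], and the
    smaller colours select from the initial part only. *)
Lemma avoids_colorwise_cat (k i : nat) (w s : seq nat) :
  all (fun x => x < k) w -> size s = size w + i ->
  avoids_colorwise k.+1 (w ++ nseq i k) s =
  avoids_colorwise k w (take (size w) s) && avoids_seq (drop (size w) s).
Proof.
move=> /allP w_lt size_s;
  rewrite /avoids_colorwise -addn1 iotaD all_cat /= andbT.
have size_take_s : size (take (size w) s) = size w.
  by rewrite size_takel // size_s leq_addr.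
have size_drop_s : size (drop (size w) s) = i by rewrite size_drop size_s addKn.
have mask_split c : mask [seq x == c | x <- w ++ nseq i k] s =
    mask [seq x == c | x <- w] (take (size w) s) ++
    (if k == c then drop (size w) s else [::]).
  rewrite -{1}(cat_take_drop (size w) s) map_cat mask_cat ?size_map //.
  congr cat; rewrite map_nseq -size_drop_s; case: eqP => _;
    last exact: mask_false.
  by rewrite mask_true.
congr andb.
  apply: eq_in_all => c; rewrite mem_iota add0n => /andP[_ c_lt].
  by rewrite mask_split gtn_eqF // cats0.
rewrite mask_split eqxx add0n (_ : mask _ _ = [::]) //.
suff -> : [seq x == k | x <- w] = nseq (size w) false by rewrite mask_false.
rewrite -(size_map (eq_op^~ k) w); apply/all_pred1P; rewrite all_map.
by apply/allP=> x /w_lt /ltn_eqF /= ->.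
Qed.

End Avoidance.

(** * Translating bi-avoidance into conditions on the colour word *)

Lemma mask_one_line (k n : nat) (s : 'S_n) (w : n.-tuple 'I_k) (c : nat) :
  mask [seq x == c | x <- [seq val y | y <- w]] (one_line s) =
  [seq (val (s i)).+1 | i <- enum 'I_n & val (tnth w i) == c].
Proof.
rewrite filter_mask map_mask; congr mask.
by rewrite -{1}[w : seq _]map_tnth_enum -!map_comp.
Qed.

(** A colour word reducing to zeros is constant, so an occurrence of a zero pattern is an ordinary
    occurrence inside one colour class. *)
Lemma avoids_zero_patterns (j k n : nat) (Y : {set 'S_j}) (x : colored_perm k
  n) :
  0 < j ->
  all (fun p => ~~ bi_occurs p x) [seq zero_pattern t | t <- enum Y] =
  avoids_colorwise Y k [seq val c | c <- x.2] (one_line x.1).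
Proof.
move=> j_gt0; rewrite all_map; apply/allP/allP=> [av c _ | av t /=].
  apply/avoids_seqP=> r t; rewrite mask_one_line => sub tY rt.
  have size_r : size r = j by rewrite -(size_one_line t) -rt size_map.
  case/subseqP: sub rt size_r => b _ ->; rewrite -map_mask size_map.
  set I := mask b _ => rt /eqP size_I.
  have : subseq I [seq i <- enum 'I_n | val (tnth x.2 i) == c] by apply:
    mask_subseq.
  rewrite subseq_filter => /andP[/all_filterP I_c I_sub].
  move: (av t); rewrite mem_enum => /(_ tY) /existsP; apply.
  exists (Tuple size_I); rewrite increasing_subseq I_sub /=.
  apply/andP; split; first exact/eqP.
  rewrite red_word_constant ?size_map ?(eqP size_I) //; apply/(constantP 0);
    exists c.
  apply/all_pred1P; rewrite all_map; apply/allP=> i.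
  by rewrite -I_c mem_filter => /andP[].
rewrite mem_enum => tY; apply/existsP=> -[I] /and3P[] /=.
rewrite increasing_subseq => I_sub /eqP rt.
rewrite red_word_constant ?size_map ?size_tuple // => /(constantP 0)[c]
  /all_pred1P.
rewrite all_map => I_c.
(* As [j] is positive, the occurrence has a first entry; its colour is [c], hence below [k]. *)
have c_lt : c < k.
  have /(allP I_c) /eqP /= <- := mem_tnth (Ordinal j_gt0) I.
  exact: ltn_ord.
have c_k : c \in iota 0 k by rewrite mem_iota.
move/avoids_seqP: (av c c_k) => /(_ [seq (val (x.1 i)).+1 | i <- I] t).
by rewrite mask_one_line => av'; apply: av' rt => //;
  rewrite map_subseq // subseq_filter I_c.
Qed.

Lemma red_word_descent (a b : nat) : (red_word [:: a; b] == [:: 1;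
  0]) = (b < a).
Proof.
by rewrite /red_word /= inE; case: (ltngtP a b) => /= [ab | ba | ->];
  rewrite ?ltnn ?ab ?ba // ltnNge ltnW.
Qed.

(** Two positions with decreasing colours carry distinct values, so they form one of the two
    patterns whichever value is larger. *)
Lemma avoids_descents (k n : nat) (x : colored_perm k n) :
  all (fun p => ~~ bi_occurs p x) [:: pattern_12_10; pattern_21_10] =
  sorted leq [seq val c | c <- x.2].
Proof.
have nth_color (i : 'I_n) : nth 0 [seq val c | c <- x.2] i = tnth x.2 i.
  by rewrite (nth_map (tnth x.2 i)) ?size_tuple // -tnth_nth.
rewrite (sorted_pairwise leq_trans) /= andbT -negb_or; apply/idP/(pairwiseP 0).
  move=> no_occ i i'; rewrite !inE !size_map !size_tuple => i_n i'_n ii'.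
  rewrite (nth_color (Ordinal i_n)) (nth_color (Ordinal i'_n)) leqNgt.
  apply: contra no_occ => desc.
  set o := Ordinal i_n in desc *; set o' := Ordinal i'_n in desc *.
  have neq_s : val (x.1 o) != val (x.1 o').
    by rewrite (inj_eq val_inj) (inj_eq perm_inj) -val_eqE /= ltn_eqF.
  case: (ltngtP (val (x.1 o)) (val (x.1 o'))) neq_s => // lt_s _; apply/orP.
    left; apply/existsP; exists [tuple o; o'].
    rewrite one_line_12 red_word_descent desc andbT.
    by rewrite /increasing /red_perm /= ii' !ltnS !ltnn lt_s ltnNge ltnW.
  right; apply/existsP; exists [tuple o; o'].
  rewrite one_line_21 red_word_descent desc andbT.
  by rewrite /increasing /red_perm /= ii' !ltnS !ltnn lt_s ltnNge ltnW.
move=> w_sorted.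
have no_descent (I : 2.-tuple 'I_n) : increasing I ->
    red_word [seq val (tnth x.2 i) | i <- I] == [:: 1; 0] -> False.
  case/tupleP: I => i I; case/tupleP: I => i' I; rewrite tuple0 /increasing /=.
  rewrite andbT red_word_descent => ii'; apply/negP;
    rewrite -leqNgt -!nth_color.
  by apply: w_sorted; rewrite ?inE ?size_map ?size_tuple.
by apply/norP; split; apply/existsP=> -[I /and3P[I_inc _]]; apply: no_descent.
Qed.

(** * Weakly increasing colour words *)

Lemma increasing_word_cat (k : nat) (w : seq nat) :
  sorted leq w -> all (fun x => x < k.+1) w ->
  w = [seq x <- w | x < k] ++ nseq (count (predC (fun x => x < k)) w) k.
Proof.
rewrite (sorted_pairwise leq_trans).
elim: w => //= x w IHw /andP[x_le w_sorted] /andP[]; rewrite ltnS => x_k w_lt.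
rewrite {1}IHw //; case: ltngtP x_k => //= xk _.
(* Here the head equals [k], and no later letter is smaller. *)
rewrite (_ : [seq _ <- w | _] = [::]) /= ?xk //.
apply/eqP; rewrite -size_eq0 size_filter -leqn0 leqNgt -has_count -all_predC.
by apply: sub_all x_le => y; rewrite xk /= -leqNgt.
Qed.

(* Here m is the position where the run of the last letter k' starts. *)
Fixpoint increasing_words (k n : nat) : seq (seq nat) :=
  if k is k'.+1 then
    [seq w ++ nseq (n - m) k' | m <- iota 0 n.+1, w <- increasing_words k' m]
  else if n is 0 then [:: [::]] else [::].

Lemma mem_increasing_words (k n : nat) (w : seq nat) :
  (w \in increasing_words k n) =
  [&& size w == n, sorted leq w & all (fun x => x < k) w].
Proof.
elim: k n w => [|k IHk] n w; first by case: n w => [|n] [|x w] //=;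
  rewrite !andbF.
apply/allpairsPdep/and3P=> [[m [v []]] | [/eqP size_w w_sorted w_lt]].
  rewrite mem_iota IHk add0n ltnS => /= m_n /and3P[/eqP size_v v_sorted v_lt]
    ->.
  rewrite size_cat size_nseq all_cat all_nseq ltnSn orbT andbT.
  split; first by rewrite size_v subnKC.
    rewrite (sorted_pairwise leq_trans) pairwise_cat -(sorted_pairwise
      leq_trans).
    rewrite v_sorted /=; apply/andP; split.
      apply/allrelP=> x y /(allP v_lt) x_lt /nseqP[-> _]; exact: ltnW.
    by elim: (n - m) => //= i ->; rewrite all_nseq leqnn orbT.
  by apply: sub_all v_lt => x; apply: leqW.
(* The run of [k] starts after all smaller letters, so their number is the cut. *)
exists (count (fun x => x < k) w), [seq x <- w | x < k].
have count_le : count (fun x => x < k) w <= n by rewrite -size_w count_size.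
rewrite mem_iota IHk add0n ltnS size_filter eqxx filter_all (sorted_filter
  leq_trans) //.
split=> //; rewrite [LHS](increasing_word_cat w_sorted w_lt);
  congr (_ ++ nseq _ k).
by rewrite -size_w -(count_predC (fun x => x < k) w) addKn.
Qed.

(** Deleting the letters [k] recovers the initial part, whose length recovers the cut. *)
Lemma increasing_words_uniq (k n : nat) : uniq (increasing_words k n).
Proof.
elim: k n => [|k IHk] n; first by case: n.
apply: allpairs_uniq_dep => [|m _|]; [exact: iota_uniq | exact: IHk |].
have filter_run (m i : nat) v :
    v \in increasing_words k m -> [seq x <- v ++ nseq i k | x < k] = v.
  rewrite mem_increasing_words => /and3P[_ _ /all_filterP v_lt].
  rewrite filter_cat v_lt -[RHS]cats0; congr cat.
  by apply/eqP; rewrite -size_eq0 size_filter count_nseq ltnn.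
move=> p q /allpairsPdep[m [v [_ vm ->]]] /allpairsPdep[m' [v' [_ v'm' ->]]] /=.
move=> /(congr1 (filter (fun x => x < k)));
  rewrite !(filter_run _ _ _ vm) (filter_run _ _ _ v'm').
move: vm v'm'; rewrite !mem_increasing_words => /and3P[/eqP <- _ _] /and3P[/eqP
  <- _ _].
by move->.
Qed.

(** * Counting by colour word, and the recursion on the number of colours *)

Definition num_colored (j : nat) (Y : {set 'S_j}) (k n : nat) : nat :=
  \sum_(w <- increasing_words k n) num_perms (avoids_colorwise Y k w) n.

(** The two descent patterns leave exactly the weakly increasing colour words; for each of them the
    remaining condition on the permutation is order invariant. *)
Lemma Av_coloredE (j : nat) (Y : {set 'S_j}) (k n : nat) :
  0 < j -> 0 < k ->
  Av_colored ([seq zero_pattern t | t <- enum Y] ++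
              [:: pattern_12_10; pattern_21_10]) n k =
  num_colored Y k n.
Proof.
case: k => // k j_gt0 _;
  set word := fun w : n.-tuple 'I_k.+1 => [seq val c | c <- w].
pose words := [seq word w | w <- enum {: n.-tuple 'I_k.+1} & sorted leq (word
  w)].
have words_perm : perm_eq (increasing_words k.+1 n) words.
  apply: uniq_perm; first exact: increasing_words_uniq.
    rewrite map_inj_uniq ; first by rewrite filter_uniq // enum_uniq.
    by move=> w w' /(inj_map val_inj) /val_inj.
  move=> w; rewrite mem_increasing_words;
    apply/and3P/mapP=> [[size_w w_sorted] | ].
    (* [inord] needs the successor form of the number of colours; by [w_lt] it changes no letter. *)
    move=> /allP w_lt; have size_w' : size [seq inord x : 'I_k.+1 | x <- w] ==
      n.
      by rewrite size_map.
    have w_eq : w = word (Tuple size_w').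
      rewrite /word /= -map_comp -[LHS]map_id;
        apply/eq_in_map=> x /w_lt x_lt /=.
      by rewrite inordK.
    by exists (Tuple size_w'); rewrite // mem_filter mem_enum -w_eq w_sorted.
  case=> v; rewrite mem_filter => /andP[v_sorted _] ->; split=> //.
    by rewrite size_map size_tuple.
  by rewrite all_map; apply/allP=> c _ /=.
rewrite /num_colored (perm_big _ words_perm) big_map big_filter big_enum_cond.
under eq_bigr => w _.
  rewrite -(count_one_line n (@avoids_colorwise_invariant _ Y k.+1 (word w))).
  over.
rewrite /Av_colored cardsE -sum1_card.
rewrite (partition_big (fun x => x.2) (fun w => sorted leq (word w))) /=;
  last first.
  by move=> x; rewrite unfold_in /bi_avoids all_cat avoids_descents => /andP[].
rewrite big_mkcond [RHS]big_mkcond; apply: eq_bigr => w _.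
case: ifP => // w_sorted; rewrite cardsE -sum1_card.
(* The fibre over the colour word [w] is a copy of ['S_n]. *)
rewrite (reindex_onto (fun s => (s, w)) (fun x => x.1)) /=; last first.
  by case=> s v /andP[_ /eqP /= ->].
apply: eq_bigl => s; rewrite !unfold_in /bi_avoids all_cat avoids_descents.
by rewrite avoids_zero_patterns // !eqxx !andbT w_sorted andbT.
Qed.

Lemma num_colored0 (j : nat) (Y : {set 'S_j}) (n : nat) :
  num_colored Y 0 n = (n == 0).
Proof. by case: n => [|n]; rewrite /num_colored /= ?big_nil ?big_seq1. Qed.

(** The index [m] is where the run of the last colour starts; the run is empty when [m] is [n]. For
    each word, [avoids_colorwise_cat] splits the condition at [m]. *)
Lemma num_coloredS (j : nat) (Y : {set 'S_j}) (k n : nat) :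
  num_colored Y k.+1 n =
  \sum_(m < n.+1) 'C(n, m) * (num_colored Y k m * Av_perm Y (n - m)).
Proof.
rewrite /num_colored big_allpairs_dep -[iota 0 n.+1]/(index_iota 0 n.+1)
  big_mkord.
apply: eq_bigr => m _; have m_n : m <= n by rewrite -ltnS.
rewrite big_distrl big_distrr big_seq [RHS]big_seq; apply: eq_bigr => w.
rewrite mem_increasing_words => /and3P[/eqP size_w _ w_lt].
rewrite Av_permE -[RHS](num_perms_take_drop m_n); last first.
- exact: avoids_seq_invariant.
- exact: avoids_colorwise_invariant.
apply: eq_in_count => p; rewrite mem_permutations => /perm_size.
rewrite size_iota => size_p.
by rewrite avoids_colorwise_cat ?size_w ?subnKC.
Qed.

(** * Passage to exponential generating functions *)

Local Open Scope ring_scope.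

Lemma egf_num_coloredS (j : nat) (Y : {set 'S_j}) (k : nat) :
  egf (num_colored Y k.+1) =1 fps_mul (egf (Av_perm Y)) (egf (num_colored Y k)).
Proof.
have fact_neq0 m : (m`!)%:R != 0 :> rat by rewrite pnatr_eq0 -lt0n fact_gt0.
move=> n; rewrite /egf /fps_mul num_coloredS natr_sum mulr_suml.
(* [fps_exp] multiplies by the new factor on the left, so the summation index is reversed. *)
rewrite (reindex_inj rev_ord_inj) /=; apply: eq_bigr => m _.
have m_n : (m <= n)%N by rewrite -ltnS.
(* Writing n! as ['C(n, m)] m! (n - m)! leaves only nonzero factors to cancel. *)
rewrite subSS subKn // bin_sub // !natrM -(bin_fact m_n) !natrM.
have bin_neq0 : 'C(n, m)%:R != 0 :> rat by rewrite pnatr_eq0 -lt0n bin_gt0.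
by field; rewrite !fact_neq0 bin_neq0.
Qed.

Lemma egf_num_colored (j : nat) (Y : {set 'S_j}) (k : nat) :
  egf (num_colored Y k) =1 fps_exp (egf (Av_perm Y)) k.
Proof.
elim: k => [|k IHk] n.
  by rewrite /egf num_colored0; case: n => //= n; rewrite mul0r.
by rewrite egf_num_coloredS; apply: eq_bigr => m _; rewrite IHk.
Qed.

Local Close Scope ring_scope.

Theorem theorem5 (j : nat) (hj : 1 <= j) (Y : {set 'S_j}) (k : nat)
    (hk : 1 <= k) :
  let Gamma :=
    [seq zero_pattern t | t <- enum Y] ++ [:: pattern_12_10; pattern_21_10] in
  egf (fun n => Av_colored Gamma n k) =1 fps_exp (egf (Av_perm Y)) k.
Proof.
move=> Gamma n; rewrite -egf_num_colored /egf /Gamma.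
by rewrite Av_coloredE.
Qed.
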